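(* Let $Z$ be a finite dimensional smooth manifold and $H$ a closed 3-form on $Z$ such that $\frac{1}{2\pi i}H$ has integral periods. Then $$H^\bullet\big(\Omega(Z)[[u, u^{-1}]],\ d+u^{-1}H\big) \cong H^\bullet(Z, H)[[u, u^{-1}]].$$
   Context: $\Omega(Z)$ is the space of (complex) differential forms on $Z$. $u$ is a formal variable of degree 2, and $V[[u,u^{-1}]]$ denotes formal series $\sum_{i\in\mathbb{Z}}v_iu^i$ (infinite in both directions) with coefficients in $V$; for $V=\Omega(Z)$ it is graded by parity. $H^\bullet(Z,H)$ is the twisted cohomology, i.e. the $\mathbb{Z}_2$-graded cohomology of $(\Omega^\bullet(Z),d+H\wedge)$. In $d+u^{-1}H$, $H$ acts by exterior multiplication. *)

(* Defs.v *)
From HB Require Import structures.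
From mathcomp Require Import all_boot all_order all_algebra.
From mathcomp Require Import complex.
From mathcomp Require Import all_classical all_reals all_analysis.

Set Implicit Arguments.
Unset Strict Implicit.
Unset Printing Implicit Defensive.

Import Order.TTheory GRing.Theory Num.Theory.
Import numFieldNormedType.Exports.

Local Open Scope classical_set_scope.
Local Open Scope ring_scope.
Local Open Scope complex_scope.
Local Open Scope quotient_scope.

(** * Smooth maps between open subsets of normed spaces *)

Section Smooth.
Context {R : realType} {U V : normedModType R}.
Implicit Types (A : set U) (f g : U -> V) (vs : seq U).

Fixpoint iterated_derive vs f : U -> V :=
  if vs is v :: vs' then 'D_v (iterated_derive vs' f) else f.

(* For an open set A of a finite dimensional space this is C^oo on A: every
   iterated directional derivative exists and is continuous at the points
   of A. *)
Definition smooth_on A f := forall vs x, A x ->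
  {for x, continuous (iterated_derive vs f)} /\
  forall v, derivable (iterated_derive vs f) x v.

Lemma near_eq_continuous f g x : (\near x, f x = g x) ->
  {for x, continuous f} -> {for x, continuous g}.
Proof.
move=> fg cf; have fgx : f x = g x := nbhs_singleton fg.
change (g @ x --> g x); rewrite -fgx.
by apply: cvg_trans cf; apply: near_eq_cvg; apply: filterS fg => y.
Qed.

Lemma iterated_derive_lin A f g (a : R) : open A ->
  smooth_on A f -> smooth_on A g -> forall vs x, A x ->
  iterated_derive vs (a \*: f + g) x =
  a *: iterated_derive vs f x + iterated_derive vs g x.
Proof.
move=> oA sf sg; elim=> [//|v vs IH] x Ax /=.
have [_ df] := sf vs x Ax; have [_ dg] := sg vs x Ax.
rewrite (@near_eq_derive _ _ _ _
  (a \*: iterated_derive vs f + iterated_derive vs g)); last first.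
  by near=> y; rewrite IH//; near: y; exact: open_nbhs_nbhs.
by rewrite deriveD ?deriveZ//; exact: derivableZ.
Unshelve. all: by end_near. Qed.

Lemma smooth_on_lin A f g (a : R) : open A ->
  smooth_on A f -> smooth_on A g -> smooth_on A (a \*: f + g).
Proof.
move=> oA sf sg vs x Ax.
have [cf df] := sf vs x Ax; have [cg dg] := sg vs x Ax.
have E : \forall y \near x,
    (a \*: iterated_derive vs f + iterated_derive vs g) y =
    iterated_derive vs (a \*: f + g) y.
  near=> y; rewrite (iterated_derive_lin _ oA)//.
  by near: y; exact: open_nbhs_nbhs.
split=> [|v].
  apply: (near_eq_continuous E).
  by apply: (@continuousD _ _ _ (a \*: iterated_derive vs f)) => //; exact: continuousZr.
apply: (near_eq_derivable E); apply: derivableD => //; exact: derivableZ.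
Unshelve. all: by end_near. Qed.

Lemma smooth_on_cst A (c : V) : smooth_on A (cst c).
Proof.
move=> vs x _.
have [c' ->] : exists c', iterated_derive vs (cst c) = cst c'.
  elim: vs => [|v vs [c' /= ->]]; first by exists c.
  by exists 0; apply/funext => y; rewrite derive_cst.
by split=> [|v]; [exact: cst_continuous | exact: derivable_cst].
Qed.

End Smooth.

Section Complex_valued.
Context {R : realType} {U : normedModType R}.
Implicit Types (A : set U) (f g : U -> R[i]).

Definition csmooth_on A f :=
  smooth_on A (fun x => complex.Re (f x)) /\
  smooth_on A (fun x => complex.Im (f x)).

Definition cderive (v : U) f (x : U) : R[i] :=
  ('D_v (fun y => complex.Re (f y)) x) +i* ('D_v (fun y => complex.Im (f y)) x).

Let complex_lin (a : R[i]) (x y z t : R) :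
  a * (x +i* y) + (z +i* t) =
  (complex.Re a * x + (- complex.Im a * y + z)) +i*
  (complex.Re a * y + (complex.Im a * x + t)).
Proof. by rewrite mulNr !addrA; case: a. Qed.

Let complexE' (z : R[i]) : z = complex.Re z +i* complex.Im z.
Proof. by case: z. Qed.

Let ReE f g (a : R[i]) : (fun x => complex.Re (a * f x + g x)) =
  complex.Re a \*: (fun x => complex.Re (f x)) +
  ((- complex.Im a) \*: (fun x => complex.Im (f x)) + (fun x => complex.Re (g x))).
Proof.
by apply/funext => x; rewrite [f x]complexE' [g x]complexE' complex_lin.
Qed.

Let ImE f g (a : R[i]) : (fun x => complex.Im (a * f x + g x)) =
  complex.Re a \*: (fun x => complex.Im (f x)) +
  (complex.Im a \*: (fun x => complex.Re (f x)) + (fun x => complex.Im (g x))).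
Proof.
by apply/funext => x; rewrite [f x]complexE' [g x]complexE' complex_lin.
Qed.

Lemma csmooth_on_lin A f g (a : R[i]) : open A ->
  csmooth_on A f -> csmooth_on A g -> csmooth_on A (fun x => a * f x + g x).
Proof.
move=> oA [f1 f2] [g1 g2]; split.
  by rewrite ReE; do 2?apply: smooth_on_lin.
by rewrite ImE; do 2?apply: smooth_on_lin.
Qed.

Lemma cderive_lin A f g (a : R[i]) v x : open A -> A x ->
  csmooth_on A f -> csmooth_on A g ->
  cderive v (fun x => a * f x + g x) x = a * cderive v f x + cderive v g x.
Proof.
move=> oA Ax [f1 f2] [g1 g2]; rewrite /cderive ReE ImE.
have /= E := fun h k b sh sk => @iterated_derive_lin R U _ A h k b oA sh sk [:: v] x Ax.
by rewrite !E//; exact: smooth_on_lin.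
Qed.

End Complex_valued.

(** * Smooth manifolds *)

Record chart (R : realType) (n : nat) (Z : topologicalType) := Chart {
  cdom : set Z ;
  cmap : Z -> 'rV[R]_n ;
  cinv : 'rV[R]_n -> Z ;
  cdom_open : open cdom ;
  cimg_open : open (cmap @` cdom) ;
  cmapK : forall z, cdom z -> cinv (cmap z) = z ;
  cmap_continuous : forall z, cdom z -> {for z, continuous cmap} ;
  cinv_continuous : forall y, (cmap @` cdom) y -> {for y, continuous cinv} }.

(* The maps cmap and cinv are total: their values outside of cdom, resp.
   cmap @` cdom, are irrelevant. *)
Definition cimg R n Z (c : @chart R n Z) : set 'rV[R]_n := cmap c @` cdom c.

Definition transition R n Z (c c' : @chart R n Z) : 'rV[R]_n -> 'rV[R]_n :=
  cmap c' \o cinv c.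

(* The atlas need not be maximal: an atlas determines the smooth structure and
   a differential form is determined by its expressions in the charts of any
   atlas. *)
Record smooth_manifold (R : realType) (n : nat) := SmoothManifold {
  carrier :> topologicalType ;
  manifold_hausdorff : hausdorff_space carrier ;
  manifold_second_countable : @second_countable carrier ;
  atlas_index : Type ;
  atlas : atlas_index -> chart R n carrier ;
  atlas_cover : forall z, exists c, cdom (atlas c) z ;
  atlas_compatible : forall c c',
    smooth_on (cmap (atlas c) @` (cdom (atlas c) `&` cdom (atlas c')))
              (transition (atlas c) (atlas c')) }.

Definition chart_at R n (Z : smooth_manifold R n) (z : Z) : atlas_index Z :=
  projT1 (cid (atlas_cover z)).

(** * Complex differential forms *)

(* A form of mixed degree on R^n is a function of a point and of a list of
   vectors; its component of degree p is its restriction to the lists of size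
   p. A form on Z is given by its expression in every chart; it is normalised
   to be 0 outside of the image of the chart. *)
Definition preform R n (Z : smooth_manifold R n) :=
  atlas_index Z -> 'rV[R]_n -> seq 'rV[R]_n -> R[i]^o.

HB.instance Definition _ R n (Z : smooth_manifold R n) :=
  GRing.Lmodule.copy (preform Z)
    (atlas_index Z -> 'rV[R]_n -> seq 'rV[R]_n -> R[i]^o).

Lemma preformE R n (Z : smooth_manifold R n) (a : R[i]) (u v : preform Z) c y s :
  (a *: u + v) c y s = a * (u c y s : R[i]) + (v c y s : R[i]) :> R[i].
Proof. by []. Qed.

Definition multilinear (R : realType) n (w : seq 'rV[R]_n -> R[i]) :=
  forall s1 s2 (a : R) x y,
    w (s1 ++ (a *: x + y) :: s2) = a%:C * w (s1 ++ x :: s2) + w (s1 ++ y :: s2).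

Definition alternating (R : realType) n (w : seq 'rV[R]_n -> R[i]) :=
  forall s, ~~ uniq s -> w s = 0.

(* An alternating w vanishes on lists of size > n, so that the elements w of
   Omega Z below, which have a component in each degree, form the direct sum
   of the spaces of p-forms for 0 <= p <= n. *)
Definition is_form R n (Z : smooth_manifold R n) (w : preform Z) : Prop :=
  [/\ forall c y, ~ cimg (atlas c) y -> w c y = 0,
      forall c y, multilinear (w c y) /\ alternating (w c y),
      forall c s, csmooth_on (cimg (atlas c)) (fun y => w c y s)
    & forall c c' y s, cimg (atlas c) y -> cdom (atlas c') (cinv (atlas c) y) ->
        let t := transition (atlas c) (atlas c') in
        w c y s = w c' (t y) [seq 'D_v t y | v <- s] ].

Definition form_pred R n (Z : smooth_manifold R n) : {pred preform Z} :=
  fun w => `[< is_form w >].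

Lemma form_submod_closed R n (Z : smooth_manifold R n) :
  submod_closed (@form_pred R n Z).
Proof.
split.
  apply/asboolP; split=> //.
  - by move=> c y; split=> [s1 s2 a u v|//]; exact/esym/(etrans (addr0 _))/mulr0.
  - by move=> c s; split; exact: smooth_on_cst.
move=> a u v /asboolP[u0 uM us uc] /asboolP[v0 vM vs vc]; apply/asboolP; split.
- move=> c y yc; apply/funext => s.
  rewrite [LHS]/(a * u c y s + v c y s) u0// v0//.
  exact: etrans (addr0 _) (mulr0 _).
- move=> c y; have [u1 u2] := uM c y; have [v1 v2] := vM c y; split.
    move=> s1 s2 b p q; rewrite ![(a *: u + v) c y _]/(a * u c y _ + v c y _).
    by rewrite u1 v1 !mulrDr !(mulrCA a) addrACA.
  move=> s us'; rewrite [LHS]/(a * u c y s + v c y s) u2// v2//.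
  exact: etrans (addr0 _) (mulr0 _).
- by move=> c s; apply: csmooth_on_lin; [exact: cimg_open | exact: us | exact: vs].
- move=> c c' y s yc yc' /=.
  rewrite ![(a *: u + v) _ _ _]/(a * u _ _ _ + v _ _ _).
  by rewrite (uc _ _ _ _ yc yc') (vc _ _ _ _ yc yc').
Qed.

HB.instance Definition _ R n (Z : smooth_manifold R n) :=
  GRing.isSubmodClosed.Build R[i] (preform Z) (@form_pred R n Z)
    (@form_submod_closed R n Z).

Record Omega R n (Z : smooth_manifold R n) :=
  Form { form_val : preform Z ; _ : form_val \in @form_pred R n Z }.

HB.instance Definition _ R n (Z : smooth_manifold R n) :=
  [isSub for @form_val R n Z].
HB.instance Definition _ R n (Z : smooth_manifold R n) :=
  [Choice of Omega Z by <:].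
HB.instance Definition _ R n (Z : smooth_manifold R n) :=
  [SubChoice_isSubLmodule of Omega Z by <:].

Definition homogeneous_form R n (Z : smooth_manifold R n) (p : nat) (w : preform Z) :=
  forall c y s, size s != p -> w c y s = 0.

(* b = false : even forms, b = true : odd forms *)
Definition has_parity R n (Z : smooth_manifold R n) (b : bool) (w : preform Z) :=
  forall c y s, odd (size s) != b -> w c y s = 0.

(* In a chart, for constant vector fields v_0, ..., v_p:
   dw(v_0,...,v_p) = \sum_i (-1)^i D_(v_i) (w(v_0,...,v_(i-1),v_(i+1),...,v_p)) *)
Definition ext_d R n (Z : smooth_manifold R n) (w : preform Z) : preform Z :=
  fun c y s =>
    if `[< cimg (atlas c) y >] then
      \sum_(i < size s) (-1) ^+ i *
        cderive s`_i (fun y' => w c y' (take i s ++ drop i.+1 s)) y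
    else 0.

(* The sign of the shuffle that moves the positions selected by m to the
   front, keeping the order within the two groups. *)
Definition shuffle_sign (R : realType) k (m : k.-tuple bool) : R[i] :=
  (-1) ^+ #|[set ij : 'I_k * 'I_k |
             [&& (ij.1 < ij.2)%N, ~~ tnth m ij.1 & tnth m ij.2]]|.

(* The exterior product, as a sum over all shuffles:
   (w1 /\ w2)(v_1,...,v_k) is the sum over the subsets {i_1 < ... < i_p} of
   {1,...,k}, with complement {j_1 < ... < j_q}, of
   sgn(i_1,...,i_p,j_1,...,j_q) w1(v_(i_1),...,v_(i_p)) w2(v_(j_1),...,v_(j_q)). *)
Definition wedge R n (Z : smooth_manifold R n) (w1 w2 : preform Z) : preform Z :=
  fun c y s => \sum_(m : (size s).-tuple bool)
    shuffle_sign R m * w1 c y (mask m s) * w2 c y (mask (map negb m) s).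

Lemma ext_d_linear R n (Z : smooth_manifold R n) :
  linear (fun w : Omega Z => ext_d (val w)).
Proof.
move=> a [u /= /asboolP[u0 _ us _]] [v /= /asboolP[v0 _ vs _]].
apply/funext => c; apply/funext => y; apply/funext => s.
rewrite [RHS]preformE /ext_d /=.
case: asboolP => [yc|_]; last by rewrite mulr0 addr0.
rewrite mulr_sumr -big_split; apply: eq_bigr => i _ /=.
rewrite mulrCA -mulrDr; congr (_ * _).
exact: (cderive_lin _ _ (@cimg_open _ _ _ (atlas c)) yc (us c _) (vs c _)).
Qed.

Lemma wedge_linear R n (Z : smooth_manifold R n) (h : preform Z) :
  linear (fun w : Omega Z => wedge h (val w)).
Proof.
move=> a u v; apply/funext => c; apply/funext => y; apply/funext => s.
rewrite [RHS]preformE /wedge.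
rewrite mulr_sumr -big_split; apply: eq_bigr => m _ /=.
rewrite preformE.
by rewrite mulrDr mulrCA.
Qed.

(** * Integral periods *)

(* The standard simplex {t_1 + ... + t_k <= 1, t_i >= 0}, with vertices 0 and
   the vectors of the canonical basis. *)
Definition simplex (R : realType) k : set 'rV[R]_k :=
  [set t | (forall i, 0 <= t ord0 i) /\ \sum_i t ord0 i <= 1].
Arguments simplex R k : clear implicits.

Definition barycentric (R : realType) k (t : 'rV[R]_k) (j : 'I_k.+1) : R :=
  if unlift ord0 j is Some i then t ord0 i else 1 - \sum_i t ord0 i.

(* The i-th face map inserts 0 as i-th barycentric coordinate. *)
Definition face (R : realType) k (i : 'I_k.+2) (t : 'rV[R]_k) : 'rV[R]_k.+1 :=
  \row_j (if unlift i (lift ord0 j) is Some l then barycentric t l else 0).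

(* A smooth singular simplex extends smoothly to a neighbourhood of the
   standard simplex; only the values on the standard simplex matter below. *)
Definition is_smooth_simplex R n (Z : smooth_manifold R n) k
    (s : 'rV[R]_k -> Z) : Prop :=
  exists U : set 'rV[R]_k, [/\ open U, simplex R k `<=` U,
    forall t, U t -> {for t, continuous s}
    & forall c, smooth_on (U `&` s @^-1` cdom (atlas c)) (cmap (atlas c) \o s)].

Record smooth_simplex R n (Z : smooth_manifold R n) k := SmoothSimplex {
  simplex_map :> 'rV[R]_k -> Z ;
  _ : is_smooth_simplex simplex_map }.

Definition smooth_chain R n (Z : smooth_manifold R n) k :=
  seq (int * smooth_simplex Z k).

(* For every singular k-simplex t, the coefficient of t in the boundary
   \sum_j \sum_i (-1)^i a_j (s_j o face_i) of the chain \sum_j a_j s_j is 0. *)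
Definition is_cycle R n (Z : smooth_manifold R n) k
    (ch : smooth_chain Z k.+1) : Prop :=
  forall t : 'rV[R]_k -> Z,
    \sum_(a <- ch) \sum_(i < k.+2)
      (-1) ^+ i * a.1 *
      (`[< forall x, simplex R k x -> a.2 (face i x) = t x >] : nat)%:Z = 0.

Definition pullback R n (Z : smooth_manifold R n) k
    (s : 'rV[R]_k -> Z) (w : preform Z) (t : 'rV[R]_k) (vs : seq 'rV[R]_k) : R[i] :=
  let c := chart_at (s t) in
  w c (cmap (atlas c) (s t)) [seq 'D_v (cmap (atlas c) \o s) t | v <- vs].

Definition integral_simplex3 (R : realType) (g : 'rV[R]_3 -> R) : R :=
  let mu := @lebesgue_measure R in
  \int[mu]_(x in `[0, 1]) \int[mu]_(y in `[0, 1 - x])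
    \int[mu]_(z in `[0, 1 - x - y]) g (\row_j [:: x; y; z]`_j).

Definition integral3 R n (Z : smooth_manifold R n)
    (w : preform Z) (s : smooth_simplex Z 3) : R[i] :=
  let g t := pullback s w t [seq delta_mx ord0 i | i <- enum 'I_3] in
  integral_simplex3 (fun t => complex.Re (g t)) +i*
  integral_simplex3 (fun t => complex.Im (g t)).

Definition integral_periods R n (Z : smooth_manifold R n) (w : preform Z) : Prop :=
  forall ch : smooth_chain Z 3, is_cycle ch ->
    exists m : int, \sum_(a <- ch) a.1%:~R * integral3 w a.2 = m%:~R.

(** * Cohomology of Z/2-graded complexes *)

(* The differential takes its values in a space [ambient] containing the
   cochains. In the two complexes below it maps cochains to cochains and has
   square 0, so that [cohomology] is the usual kernel modulo image: it is the
   space of cocycles of parity b modulo those which are the differential of a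
   cochain of the opposite parity. *)
Record z2complex (K : pzRingType) := Z2Complex {
  cochain : lmodType K ;
  ambient : lmodType K ;
  incl : {linear cochain -> ambient} ;
  diff : {linear cochain -> ambient} ;
  parity : bool -> cochain -> Prop ;
  parity0 : forall b, parity b 0 ;
  parity_lin : forall b a x y, parity b x -> parity b y -> parity b (a *: x + y) }.

Section Cohomology.
Context {K : pzRingType} (X : z2complex K) (b : bool).

Definition cocycle_pred : {pred cochain X} :=
  fun x => `[< parity b x /\ diff X x = 0 >].

Lemma cocycle_submod_closed : submod_closed cocycle_pred.
Proof.
split; first by apply/asboolP; rewrite linear0; split=> //; exact: parity0.
move=> a x y /asboolP[xp xd] /asboolP[yp yd]; apply/asboolP; split.
  exact: parity_lin.
by rewrite linearP xd yd scaler0 addr0.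
Qed.

HB.instance Definition _ :=
  GRing.isSubmodClosed.Build K (cochain X) cocycle_pred cocycle_submod_closed.

Record cocycle := Cocycle { cocycle_val : cochain X ; _ : cocycle_val \in cocycle_pred }.

HB.instance Definition _ := [isSub for cocycle_val].
HB.instance Definition _ := [Choice of cocycle by <:].
HB.instance Definition _ := [SubChoice_isSubLmodule of cocycle by <:].

Definition coboundary : {pred cocycle} :=
  fun x => `[< exists2 y, parity (~~ b) y & diff X y = incl X (val x) >].

Lemma coboundary_submod_closed : submod_closed coboundary.
Proof.
split; first by apply/asboolP; exists 0; [exact: parity0 | rewrite !linear0].
move=> a x y /asboolP[x' xp xd] /asboolP[y' yp yd]; apply/asboolP.
by exists (a *: x' + y'); [exact: parity_lin | rewrite !linearP xd yd].
Qed.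

HB.instance Definition _ :=
  GRing.isSubmodClosed.Build K cocycle coboundary coboundary_submod_closed.

Definition cohomology := Quotient.quot coboundary.

HB.instance Definition _ := GRing.Zmodule.on cohomology.

Definition cohomology_class (x : cocycle) : cohomology := \pi x.

Definition cohomology_scale (a : K) (x : cohomology) : cohomology :=
  cohomology_class (a *: repr x).

Lemma cohomology_classE (x y : cocycle) :
  (cohomology_class x == cohomology_class y) = (x - y \in coboundary).
Proof. by rewrite Quotient.idealrBE. Qed.

Lemma cohomology_class_is_zmod_morphism : zmod_morphism cohomology_class.
Proof. by move=> x y; rewrite /cohomology_class !piE. Qed.

HB.instance Definition _ :=
  GRing.isZmodMorphism.Build cocycle cohomology cohomology_class
    cohomology_class_is_zmod_morphism.

Lemma cohomology_class_repr (x : cohomology) : cohomology_class (repr x) = x.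
Proof. exact: reprK. Qed.

Lemma cohomology_classZ a x :
  cohomology_class (a *: x) = cohomology_scale a (cohomology_class x).
Proof.
apply/eqP; rewrite cohomology_classE -scalerBr; apply: rpredZ.
by rewrite -cohomology_classE cohomology_class_repr.
Qed.

Lemma cohomology_scaleA a a' x :
  cohomology_scale a (cohomology_scale a' x) = cohomology_scale (a * a') x.
Proof.
by rewrite -[x]cohomology_class_repr -!cohomology_classZ scalerA.
Qed.

Lemma cohomology_scale1 : left_id 1 cohomology_scale.
Proof.
by move=> x; rewrite -[x in LHS]cohomology_class_repr -cohomology_classZ scale1r
  cohomology_class_repr.
Qed.

Lemma cohomology_scaleDr : right_distributive cohomology_scale +%R.
Proof.
move=> a x y; rewrite -[x]cohomology_class_repr -[y]cohomology_class_repr.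
by rewrite -raddfD -!cohomology_classZ scalerDr raddfD.
Qed.

Lemma cohomology_scaleDl x : {morph cohomology_scale^~ x : a a' / a + a'}.
Proof.
move=> a a'; rewrite -[x]cohomology_class_repr.
by rewrite -!cohomology_classZ scalerDl raddfD.
Qed.

HB.instance Definition _ :=
  GRing.Zmodule_isLmodule.Build K cohomology cohomology_scaleA cohomology_scale1
    cohomology_scaleDr cohomology_scaleDl.

HB.instance Definition _ :=
  GRing.isScalable.Build K cocycle cohomology *:%R cohomology_class
    cohomology_classZ.

End Cohomology.

(** * Formal series in u and u^-1 *)

(* \sum_k v_k u^k is the function k |-> v_k. *)
Definition laurent (V : Type) := int -> V.

HB.instance Definition _ (K : pzRingType) (V : lmodType K) :=
  GRing.Lmodule.copy (laurent V) (int -> V).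

Definition u_mul (V : Type) (x : laurent V) : laurent V := fun k => x (k - 1).

(** * The complexes (Omega Z, d + H) and (Omega Z [[u, u^-1]], d + u^-1 H) *)

Section Complexes.
Context (R : realType) (n : nat) (Z : smooth_manifold R n) (H : Omega Z).

Definition twisted_diff (w : Omega Z) : preform Z :=
  ext_d (val w) + wedge (val H) (val w).

Definition laurent_diff (w : laurent (Omega Z)) : laurent (preform Z) :=
  fun k => ext_d (val (w k)) + wedge (val H) (val (w (k + 1))).

Definition laurent_incl (w : laurent (Omega Z)) : laurent (preform Z) :=
  fun k => val (w k).

Definition laurent_parity (b : bool) (w : laurent (Omega Z)) :=
  forall k, has_parity b (val (w k)).

Lemma twisted_diff_linear : linear twisted_diff.
Proof.
move=> a x y; rewrite /twisted_diff.
by rewrite [ext_d _]ext_d_linear [wedge _ _]wedge_linear scalerDr addrACA.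
Qed.

Lemma laurent_diff_linear : linear laurent_diff.
Proof.
move=> a x y; apply/funext => k.
rewrite [RHS]/(a *: laurent_diff x k + laurent_diff y k) /laurent_diff.
by rewrite [ext_d _]ext_d_linear [wedge _ _]wedge_linear scalerDr addrACA.
Qed.

Lemma laurent_incl_linear : linear laurent_incl.
Proof. by []. Qed.

HB.instance Definition _ :=
  GRing.isLinear.Build R[i] (Omega Z) (preform Z) *:%R twisted_diff
    twisted_diff_linear.
HB.instance Definition _ :=
  GRing.isLinear.Build R[i] (laurent (Omega Z)) (laurent (preform Z)) *:%R
    laurent_diff laurent_diff_linear.
HB.instance Definition _ :=
  GRing.isLinear.Build R[i] (laurent (Omega Z)) (laurent (preform Z)) *:%R
    laurent_incl laurent_incl_linear.

Lemma has_parity0 b : has_parity b (val (0 : Omega Z)).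
Proof. by []. Qed.

Lemma has_parity_lin b a (x y : Omega Z) :
  has_parity b (val x) -> has_parity b (val y) -> has_parity b (val (a *: x + y)).
Proof.
by move=> xb yb c z s sb; rewrite [LHS](preformE a (val x) (val y)) xb// yb// mulr0 addr0.
Qed.

Definition twisted_complex : z2complex R[i] :=
  @Z2Complex R[i] (Omega Z) (preform Z) val twisted_diff
    (fun b w => has_parity b (val w)) has_parity0 has_parity_lin.

Lemma laurent_parity0 b : laurent_parity b 0.
Proof. by []. Qed.

Lemma laurent_parity_lin b a x y :
  laurent_parity b x -> laurent_parity b y -> laurent_parity b (a *: x + y).
Proof. by move=> xb yb k; exact: has_parity_lin. Qed.

Definition laurent_complex : z2complex R[i] :=
  @Z2Complex R[i] (laurent (Omega Z)) (laurent (preform Z)) laurent_incl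
    laurent_diff laurent_parity laurent_parity0 laurent_parity_lin.

End Complexes.

(* Main.v *)
(** Give u degree 2.  A component of form degree p of the coefficient of u^k has
    total degree 2k + p, and both d and u^-1 H raise the total degree by 1.
    Grouping the components by total degree instead of by the power of u turns
    d + u^-1 H into d + H acting on each coefficient.  The regrouping only shifts
    the index k by a function of p, so it is invertible: as a form has finitely
    many components and series are infinite in both directions, no finiteness
    or convergence condition has to be checked. *)
Require Import Defs.
From HB Require Import structures.
From mathcomp Require Import all_boot all_order all_algebra.
From mathcomp Require Import complex.
From mathcomp Require Import all_classical all_reals all_analysis.
From mathcomp Require Import zify.

Import GRing.Theory.

Local Open Scope ring_scope.
Local Open Scope complex_scope.

(** * Shifting the powers of u by the form degree *)

Section Regrade.
Context {R : realType} {n : nat} {Z : smooth_manifold R n}.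
Implicit Types (sigma : nat -> int) (w : laurent (Omega Z)).

(** Each condition in [is_form] only relates values on lists of equal size, so it can be checked
    degree by degree, each degree taking it from its own coefficient of [w]. *)
Lemma regrade_subproof sigma w (k : int) :
  (fun c y s => val (w (k + sigma (size s))) c y s) \in @form_pred R n Z.
Proof.
have F j : is_form (val (w j)) by case: (w j) => v /= /asboolP.
apply/asboolP; split.
- by move=> c y yc; apply/funext => s; have [-> //] := F (k + sigma (size s)).
- move=> c y; split=> [s1 s2 a x z|s us].
    rewrite !size_cat /=.
    by have [_ /(_ c y)[M _] _ _] := F (k + sigma (size s1 + (size s2).+1)%N); exact: M.
  by have [_ /(_ c y)[_ A] _ _] := F (k + sigma (size s)); exact: A.
- by move=> c s; have [_ _ S _] := F (k + sigma (size s)); exact: S.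
- move=> c c' y s yc yc' /=; rewrite size_map.
  by have [_ _ _ T] := F (k + sigma (size s)); exact: T.
Qed.

Definition regrade sigma w : laurent (Omega Z) :=
  fun k => Form (regrade_subproof sigma w k).

Lemma regradeE sigma w k c y s :
  val (regrade sigma w k) c y s = val (w (k + sigma (size s))) c y s.
Proof. by []. Qed.

Lemma regradeK sigma tau w :
  (forall p, tau p = - sigma p) -> regrade sigma (regrade tau w) = w.
Proof.
move=> st; apply/funext => k; apply/val_inj.
apply/funext => c; apply/funext => y; apply/funext => s.
by rewrite !regradeE st addrK.
Qed.

Lemma regrade_linear sigma a v w k :
  regrade sigma (a *: v + w) k = a *: regrade sigma v k + regrade sigma w k.
Proof.
apply/val_inj; rewrite linearP.
apply/funext => c; apply/funext => y; apply/funext => s.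
rewrite preformE !regradeE.
by rewrite [(a *: v + w) _]/(a *: v _ + w _) linearP preformE.
Qed.

Lemma regrade_parity sigma b w :
  laurent_parity b w -> laurent_parity b (regrade sigma w).
Proof. by move=> wb k c y s sb; rewrite regradeE wb. Qed.

(** On p + 1 vectors [ext_d] evaluates the form on p vectors only, so a single coefficient of [w]
    enters. On the empty list the sum is empty and any [j] will do. *)
Lemma ext_d_regrade sigma w k j c y s :
  (forall p, size s = p.+1 -> k + sigma p = j) ->
  ext_d (val (regrade sigma w k)) c y s = ext_d (val (w j)) c y s.
Proof.
move=> kj; rewrite /ext_d; case: asboolP => // _ /=.
apply: eq_bigr => i _.
have -> : k + sigma (size (take i s ++ drop i.+1 s)) = j => //.
apply: kj; have si := ltn_ord i; rewrite size_cat size_take size_drop si; lia.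
Qed.

Lemma size_mask_negb T (m : bitseq) (s : seq T) : size m = size s ->
  (size (mask m s) + size (mask (map negb m) s))%N = size s.
Proof.
move=> ms; rewrite !size_mask ?size_map// count_map -ms.
exact: (count_predC id m).
Qed.

(** Only shuffles giving exactly [d] vectors to [h] contribute, so the other factor always sees
    [size s - d] vectors. *)
Lemma wedge_regrade (h : preform Z) d sigma w k j c y s :
  homogeneous_form d h ->
  (forall p, size s = (d + p)%N -> k + sigma p = j) ->
  wedge h (val (regrade sigma w k)) c y s = wedge h (val (w j)) c y s.
Proof.
move=> hd kj; rewrite /wedge; apply: eq_bigr => m _.
have [md|md] := eqVneq (size (mask m s)) d; last first.
  by rewrite hd// mulr0 !mul0r.
by rewrite regradeE kj// -md size_mask_negb ?size_tuple.
Qed.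

(* With offset 0 for the cocycles of a parity and offset 1 for the cochains of the
   opposite parity that bound them, no case distinction on the parity is needed. *)
Definition degree_shift (e p : nat) : int := - ((p + e)./2)%:Z.

(** In degree q, d reads [w] in degree q - 1 and the product with [H] reads it in degree q - 3.
    Lowering the degree by 2 raises [degree_shift] by 1, which is the index offset caused by the
    factor u^-1. *)
Lemma twisted_diff_regrade (H : Omega Z) e w k c y s :
  homogeneous_form 3 (form_val H) ->
  twisted_diff H (regrade (degree_shift e) w k) c y s =
  laurent_diff H w (k + degree_shift e (size s).-1) c y s.
Proof.
move=> H3; rewrite /twisted_diff /laurent_diff.
set k' := k + _.
rewrite [LHS]/(ext_d _ c y s + wedge _ _ c y s).
rewrite [RHS]/(ext_d _ c y s + wedge _ _ c y s).
rewrite (@ext_d_regrade _ _ _ k'); last by move=> p sp; rewrite /k' sp.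
rewrite (@wedge_regrade _ 3 _ _ _ (k' + 1))// => p sp.
rewrite /k' /degree_shift sp; lia.
Qed.

End Regrade.

Lemma cocycle_val_linear {K : pzRingType} {X : z2complex K} {b} :
  linear (fun x : cocycle X b => cocycle_val x).
Proof. exact: (@linearP K _ _ *:%R val). Qed.

(** * Cocycles and coboundaries under regrading *)

Section Cohomology_iso.
Context {R : realType} {n : nat} {Z : smooth_manifold R n} {H : Omega Z}.
Context (H_deg3 : homogeneous_form 3 (form_val H)).
Context {b : bool}.
Local Notation lcocycle := (cocycle (laurent_complex H) b).
Local Notation tcocycle := (cocycle (twisted_complex H) b).

Lemma laurent_diff_eq0 e (w : laurent (Omega Z)) :
  laurent_diff H w = 0 <->
  forall k, twisted_diff H (regrade (degree_shift e) w k) = 0.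
Proof.
split=> [w0 k|w0].
  apply/funext => c; apply/funext => y; apply/funext => s.
  by rewrite twisted_diff_regrade// w0.
apply/funext => k; apply/funext => c; apply/funext => y; apply/funext => s.
(* For each list [s], the regraded coefficient used is the one that the shift moves to [k]. *)
by rewrite -[k](subrK (degree_shift e (size s).-1)) -twisted_diff_regrade// w0.
Qed.

Lemma laurent_diff_eq_incl (v w : laurent (Omega Z)) :
  laurent_diff H v = laurent_incl w <->
  forall k, twisted_diff H (regrade (degree_shift 1) v k) =
            val (regrade (degree_shift 0) w k).
Proof.
have shiftE p : degree_shift 1 p.-1 = degree_shift 0 p.
  (* For p = 0 both shifts are 0, since [0.-1] is 0 and [1./2] is 0. *)
  by rewrite /degree_shift addn0 addn1; case: p.
split=> [vw k|vw].
  apply/funext => c; apply/funext => y; apply/funext => s.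
  by rewrite twisted_diff_regrade// vw regradeE shiftE.
apply/funext => k; apply/funext => c; apply/funext => y; apply/funext => s.
rewrite -[k](subrK (degree_shift 0 (size s))) -[X in _ + X]shiftE.
by rewrite -twisted_diff_regrade// vw regradeE shiftE.
Qed.

Lemma regrade_cocycle_subproof (x : lcocycle) k :
  regrade (degree_shift 0) (cocycle_val x) k \in @cocycle_pred _ (twisted_complex H) b.
Proof.
case: x => x /= /asboolP[xb /(laurent_diff_eq0 0) x0].
by apply/asboolP; split; [exact: regrade_parity | exact: x0].
Qed.

Definition regrade_cocycle (x : lcocycle) : laurent tcocycle :=
  fun k => Cocycle (regrade_cocycle_subproof x k).

Lemma ungrade_cocycle_subproof (v : laurent tcocycle) :
  regrade (fun p => - degree_shift 0 p) (fun k => cocycle_val (v k))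
    \in @cocycle_pred _ (laurent_complex H) b.
Proof.
have V k : has_parity b (val (cocycle_val (v k))) /\
      twisted_diff H (cocycle_val (v k)) = 0.
  by case: (v k) => x /= /asboolP.
apply/asboolP; split.
  by apply: regrade_parity => k; have [] := V k.
apply/(laurent_diff_eq0 0) => k; rewrite regradeK//.
by have [] := V k.
Qed.

Definition ungrade_cocycle (v : laurent tcocycle) : lcocycle :=
  Cocycle (ungrade_cocycle_subproof v).

Lemma ungrade_cocycleK : cancel ungrade_cocycle regrade_cocycle.
Proof.
move=> v; apply/funext => k; apply/val_inj.
by rewrite /= regradeK.
Qed.

Lemma regrade_cocycle_linear : linear regrade_cocycle.
Proof.
move=> a x y; apply/funext => k; apply/val_inj.
rewrite [(a *: _ + _) k]/(a *: regrade_cocycle x k + regrade_cocycle y k).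
rewrite [RHS](cocycle_val_linear a (regrade_cocycle x k)).
rewrite [LHS]/(regrade _ (cocycle_val (a *: x + y)) k) cocycle_val_linear.
exact: regrade_linear.
Qed.

Lemma regrade_coboundary (x : lcocycle) :
  (x \in @coboundary _ (laurent_complex H) b) <->
  forall k, regrade_cocycle x k \in @coboundary _ (twisted_complex H) b.
Proof.
split=> [/asboolP[v vb /laurent_diff_eq_incl vx] k|xb].
  apply/asboolP; exists (regrade (degree_shift 1) v k); last exact: vx.
  exact: (regrade_parity _ _ _ vb).
have {}xb k : exists v : Omega Z, has_parity (~~ b) (val v) /\
    twisted_diff H v = val (regrade (degree_shift 0) (cocycle_val x) k).
  by have /asboolP[v vb vx] := xb k; exists v.
(* The bounding cochains can be chosen independently for each [k]: any family indexed by the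
   integers is a series, and undoing the shift of offset 1 assembles them. *)
have [v vP] := choice xb.
apply/asboolP; exists (regrade (fun p => - degree_shift 1 p) v).
  by apply: regrade_parity => k; have [] := vP k.
apply/laurent_diff_eq_incl => k; rewrite regradeK//.
by have [] := vP k.
Qed.

(** * The isomorphism in cohomology *)

Definition regrade_cohomology (x : cohomology (laurent_complex H) b) :
    laurent (cohomology (twisted_complex H) b) :=
  fun k => cohomology_class (regrade_cocycle (repr x) k).

Lemma regrade_cocycleB x y k :
  regrade_cocycle (x - y) k = regrade_cocycle x k - regrade_cocycle y k.
Proof. by rewrite (zmod_morphism_linear regrade_cocycle_linear). Qed.

(** Independence of the representative: two representatives differ by a coboundary, and regrading
    preserves coboundaries. *)
Lemma regrade_cohomology_class x k :
  regrade_cohomology (cohomology_class x) k =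
  cohomology_class (regrade_cocycle x k).
Proof.
apply/eqP; rewrite cohomology_classE -regrade_cocycleB.
apply: (regrade_coboundary _).1.
by rewrite -cohomology_classE cohomology_class_repr.
Qed.

Lemma regrade_cohomology_linear : linear regrade_cohomology.
Proof.
move=> a x y; apply/funext => k.
rewrite [RHS]/(a *: regrade_cohomology x k + regrade_cohomology y k).
rewrite -[x in LHS]cohomology_class_repr -[y in LHS]cohomology_class_repr.
rewrite -[in LHS](linearP (@cohomology_class _ (laurent_complex H) b)).
rewrite regrade_cohomology_class regrade_cocycle_linear.
exact: (linearP (@cohomology_class _ (twisted_complex H) b)).
Qed.

HB.instance Definition _ :=
  GRing.isLinear.Build R[i] (cohomology (laurent_complex H) b)
    (laurent (cohomology (twisted_complex H) b)) *:%R regrade_cohomology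
    regrade_cohomology_linear.

Lemma regrade_cohomology_bij : bijective regrade_cohomology.
Proof.
pose psi (v : laurent (cohomology (twisted_complex H) b)) :
    cohomology (laurent_complex H) b :=
  cohomology_class (ungrade_cocycle (fun k => repr (v k))).
have psiK : cancel psi regrade_cohomology.
  move=> v; apply/funext => k.
  by rewrite regrade_cohomology_class ungrade_cocycleK cohomology_class_repr.
(* As [psi] is a right inverse, injectivity suffices; it holds because regrading also reflects
   coboundaries. *)
exists psi => //; apply: inj_can_sym psiK _ => x y.
rewrite -[x]cohomology_class_repr -[y]cohomology_class_repr => xy.
apply/eqP; rewrite cohomology_classE; apply/regrade_coboundary => k.
rewrite regrade_cocycleB -cohomology_classE -!regrade_cohomology_class.
by rewrite xy.
Qed.

(** Multiplication by u translates [k] by a constant, while regrading translates it by an amount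
    depending on the form degree alone, so the two commute. *)
Lemma regrade_cohomology_u (x y : lcocycle) :
  cocycle_val y = u_mul (cocycle_val x) ->
  regrade_cohomology (cohomology_class y) =
  u_mul (regrade_cohomology (cohomology_class x)).
Proof.
move=> yx; apply/funext => k; rewrite /u_mul !regrade_cohomology_class.
congr cohomology_class; do 2!apply/val_inj.
apply/funext => c; apply/funext => z; apply/funext => s.
by rewrite /= yx /u_mul addrAC.
Qed.

End Cohomology_iso.

Theorem lemma4p3 (R : realType) (n : nat) (Z : smooth_manifold R n)
    (H : Omega Z)
    (H_deg3 : homogeneous_form 3 (form_val H))
    (H_closed : ext_d (form_val H) = 0)
    (H_integral : integral_periods (((2 * pi)*i)^-1 *: form_val H)) :
  exists phi : forall b : bool,
      {linear cohomology (laurent_complex H) b ->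
              laurent (cohomology (twisted_complex H) b)},
    forall b : bool,
      bijective (phi b) /\
      (forall x y : cocycle (laurent_complex H) b,
         cocycle_val y = u_mul (cocycle_val x) ->
         phi b (cohomology_class y) = u_mul (phi b (cohomology_class x))).
Proof.
exists (fun b => regrade_cohomology H_deg3 : {linear _ -> _}) => b.
split; [exact: regrade_cohomology_bij | exact: regrade_cohomology_u].
Qed.
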